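(* Let $C\subset N$ and let $\beta$ be a nonnegative integer with $\beta<|C|$. If the inequality $\sum_{j\in C}x_j\leq\beta$ is valid for the quadratic knapsack problem, i.e. it holds for every $x\in\{0,1\}^n$ with $w^Tx\leq c$, then every inequality in the SCILS derived from it, i.e. every inequality $$\sum_{(i,j)\in C_s}X_{ij}\leq\left\lfloor\frac{\beta}{2}\right\rfloor$$ with $C_s$ an admissible partition for $(C,\beta)$, is valid for the lifted problem, i.e. it holds for every $(x,X)$ with $x\in\{0,1\}^n$, $w^Tx\leq c$ and $X=xx^T$.
   Context: Let $N=\{1,\ldots,n\}$, let $w\in\mathbb{Z}^n$ have positive entries, and let $c$ be a positive integer with $c\geq w_i$ for all $i\in N$. The quadratic knapsack problem has feasible set $\{x\in\{0,1\}^n : w^Tx\leq c\}$, and its lifted version has feasible set $\{(x,X)\in\{0,1\}^n\times\mathbb{S}^n : w^Tx\leq c,\ X=xx^T\}$, where $\mathbb{S}^n$ is the set of real symmetric $n\times n$ matrices. Admissible partitions. Below, a partition of a set into pairs is written as a list of pairs $(i_1,j_1),\ldots,(i_p,j_p)$ with $i_k<j_k$ for all $k$. For $C$ and $\beta$ as in the claim, $C_s$ is admissible if it is of the following form: (1) if $|C|$ is even: $C_s=\{(i_1,j_1),\ldots,(i_p,j_p)\}$ is a partition of $C$ into pairs; (2) if $|C|$ is odd and $\beta$ is odd: $C_s=\{(i_1,j_1),\ldots,(i_p,j_p)\}$ is a partition of $C\setminus\{i_0\}$ into pairs, for some $i_0\in C$; (3) if $|C|$ is odd and $\beta$ is even: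 $C_s=\{(i_0,i_0),(i_1,j_1),\ldots,(i_p,j_p)\}$, where $i_0\in C$ and $\{(i_1,j_1),\ldots,(i_p,j_p)\}$ is a partition of $C\setminus\{i_0\}$ into pairs. The set of all inequalities $\sum_{(i,j)\in C_s}X_{ij}\leq\lfloor\beta/2\rfloor$ over all admissible $C_s$ (all choices of $i_0$ and of the pairing) is called the set of cover inequalities in the lifted space (SCILS) derived from $\sum_{j\in C}x_j\leq\beta$. *)

(* Defs.v *)
From mathcomp Require Import all_boot all_order all_algebra.
From mathcomp Require Import reals.

Set Implicit Arguments.
Unset Strict Implicit.
Unset Printing Implicit Defensive.

Import Order.TTheory GRing.Theory Num.Theory.
Local Open Scope ring_scope.

Definition valid_for (T : Type) (F ineq : T -> Prop) : Prop :=
  forall t : T, F t -> ineq t.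

Definition qkp_feasible (R : realType) (n : nat) (w : 'cV[int]_n) (c : int)
    (x : 'cV[R]_n) : Prop :=
  (forall i, x i 0 = 0 \/ x i 0 = 1) /\
  ((map_mx intr w)^T *m x) 0 0 <= c%:~R.

Definition lifted_feasible (R : realType) (n : nat) (w : 'cV[int]_n) (c : int)
    (xX : 'cV[R]_n * 'M[R]_n) : Prop :=
  [/\ qkp_feasible w c xX.1, xX.2 \is symmetricmx & xX.2 = xX.1 *m xX.1^T].

Definition cover_ineq (R : realType) (n : nat) (C : {set 'I_n}) (beta : nat)
    (x : 'cV[R]_n) : Prop :=
  \sum_(j in C) x j 0 <= beta%:R.

Definition lifted_ineq (R : realType) (n : nat) (Cs : {set 'I_n * 'I_n})
    (beta : nat) (xX : 'cV[R]_n * 'M[R]_n) : Prop :=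
  \sum_(p in Cs) xX.2 p.1 p.2 <= (beta./2)%:R.

(* Since i < j, the map (i, j) |-> [set i; j] is injective on P, so forming its
   image as a set does not identify distinct pairs. *)
Definition pair_partition (n : nat) (P : {set 'I_n * 'I_n}) (D : {set 'I_n}) :
    bool :=
  [forall p in P, (p.1 < p.2)%N] &&
  partition [set [set p.1; p.2] | p : 'I_n * 'I_n in P] D.

Definition admissible (n : nat) (C : {set 'I_n}) (beta : nat)
    (Cs : {set 'I_n * 'I_n}) : Prop :=
  [\/ ~~ odd #|C| /\ pair_partition Cs C,
      [/\ odd #|C|, odd beta &
        exists2 i0, i0 \in C & pair_partition Cs (C :\ i0)]
    | [/\ odd #|C|, ~~ odd beta &
        exists i0 (P : {set 'I_n * 'I_n}),
          [/\ i0 \in C, pair_partition P (C :\ i0) & Cs = (i0, i0) |: P]]].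

(* Main.v *)
Require Import Defs.
From mathcomp Require Import all_boot all_order all_algebra.
From mathcomp Require Import reals.
From mathcomp Require Import zify.

Set Implicit Arguments.
Unset Strict Implicit.
Unset Printing Implicit Defensive.

Import Order.TTheory GRing.Theory Num.Theory.
Local Open Scope ring_scope.

(** On a lifted feasible point, [X = x x^T] with [x] the 0/1 indicator vector
    of a set [S], so [X i j] is 1 exactly when both [i] and [j] lie in [S], and
    validity of the cover inequality says that at most [beta] elements of [C]
    lie in [S].  A pair of the partition with [X i j = 1] uses up two elements
    of [C :&: S], and distinct pairs are disjoint.  Hence twice the number of
    such pairs is at most [beta] ([double_sum_pairs_le]), and integrality gives
    the bound [beta./2].

    When the diagonal pair [(i0, i0)] is present, it may contribute 1 while
    using up a single element, which only gives the bound [beta + 1] on twice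
    the left-hand side; but then [beta] is even, so rounding down absorbs the
    extra unit. *)

(** The order on the two components makes a pair recoverable from its
    underlying set. *)
Lemma set2_ltn_inj n (a b : 'I_n * 'I_n) :
  (a.1 < a.2)%N -> (b.1 < b.2)%N ->
  [set a.1; a.2] = [set b.1; b.2] -> a = b.
Proof.
case: a b => [i j] [k l] /= ltij ltkl eq_set.
have := set21 i j; have := set22 i j; rewrite eq_set !in_set2.
move=> /pred2P[] jE /pred2P[] iE; subst i j => //.
- by rewrite ltnn in ltij.
- by have := ltn_trans ltij ltkl; rewrite ltnn.
- by rewrite ltnn in ltij.
Qed.

(** Distinct pairs of [P] give distinct blocks, so summing over the blocks of
    the partition is summing over [P]. *)
Lemma big_pair_partition n (P : {set 'I_n * 'I_n}) (D : {set 'I_n})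
    (V : nmodType) (f : 'I_n -> V) :
  pair_partition P D -> \sum_(i in D) f i = \sum_(p in P) (f p.1 + f p.2).
Proof.
move=> /andP[/forall_inP ltP partP].
have [/eqP <- trivP _] := and3P partP.
rewrite big_trivIset //= big_imset /=; last first.
  by move=> a b /ltP lta /ltP ltb; apply: set2_ltn_inj.
apply: eq_bigr => p /ltP ltp.
by rewrite big_setU1 ?big_set1 // in_set1 -val_eqE /= neq_ltn ltp.
Qed.

(** For 0/1 values, [2 a b <= a + b]; summing this over disjoint pairs bounds
    the quadratic expression by the linear one. *)
Lemma double_sum_pairs_le n (P : {set 'I_n * 'I_n}) (D S : {set 'I_n}) :
  pair_partition P D ->
  ((\sum_(p in P) ((p.1 \in S) && (p.2 \in S))).*2 <=
     \sum_(i in D) (i \in S))%N.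
Proof.
move=> partP.
rewrite (big_pair_partition (fun i => (i \in S) : nat) partP).
rewrite -mul2n big_distrr /=; apply: leq_sum => p _.
by case: (p.1 \in S); case: (p.2 \in S).
Qed.

Lemma admissible_sum_le n (C S : {set 'I_n}) (beta : nat)
    (Cs : {set 'I_n * 'I_n}) :
  admissible C beta Cs -> (\sum_(i in C) (i \in S) <= beta)%N ->
  (\sum_(p in Cs) ((p.1 \in S) && (p.2 \in S)) <= beta./2)%N.
Proof.
move=> admCs leC; rewrite geq_half_double.
case: admCs => [[_ partCs] | [_ _ [i0 i0C partCs]]
               | [_ even_beta [i0 [P [i0C partP ->]]]]].
- exact: leq_trans (double_sum_pairs_le S partCs) leC.
- apply: leq_trans (double_sum_pairs_le S partCs) (leq_trans _ leC).
  by rewrite [leqRHS](big_setD1 i0) //= leq_addl.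
- have i0P : (i0, i0) \notin P.
    have /andP[/forall_inP ltP _] := partP.
    by apply/negP => /ltP; rewrite ltnn.
  have leP := double_sum_pairs_le S partP.
  (* With k full pairs and i0 in S, leC and leP give 2k + 1 <= beta; as beta
     is even this is 2k + 2 <= beta. *)
  rewrite big_setU1 //= andbb.
  by move: leC leP; rewrite (big_setD1 i0) //=; case: (i0 \in S); lia.
Qed.

Theorem theorem15 (R : realType) (n : nat) (w : 'cV[int]_n) (c : int)
    (w_gt0 : forall i, 0 < w i 0) (c_gt0 : 0 < c) (w_le_c : forall i, w i 0 <= c)
    (C : {set 'I_n}) (beta : nat) (beta_lt : (beta < #|C|)%N)
    (cover_valid : valid_for (@qkp_feasible R n w c) (cover_ineq C beta)) :
  forall Cs : {set 'I_n * 'I_n}, admissible C beta Cs ->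
    valid_for (@lifted_feasible R n w c) (lifted_ineq Cs beta).
Proof.
move=> Cs admCs [x X] [/= feas_x _ ->].
pose S := [set i | x i 0 == 1].
have xE i : x i 0 = (i \in S)%:R.
  rewrite inE; case: (feas_x.1 i) => ->; last by rewrite eqxx.
  by rewrite eq_sym oner_eq0.
have leC : (\sum_(i in C) (i \in S) <= beta)%N.
  rewrite -(ler_nat R) natr_sum.
  by have := cover_valid x feas_x; rewrite /cover_ineq (eq_bigr _ (fun i _ => xE i)).
rewrite /lifted_ineq /=.
under eq_bigr => p _ do
  rewrite mxE big_ord1 !mxE !xE -natrM mulnb.
by rewrite -natr_sum ler_nat; apply: admissible_sum_le leC.
Qed.
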